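(* Let $\mathbb F$ and $\mathbb H$ be bivariant theories on a category $\mathcal C$ with final object $pt$, and let $c_*:F(X)=\mathbb F(X\to pt)\to\mathbb H(X\to pt)=H_*(X)$ be a natural transformation of the associated covariant theories which commutes with exterior products and maps the unit $1_{pt}\in F(pt)$ to the unit $1_{pt}\in H_*(pt)$. Let $\mathbb{PH}(X\xrightarrow{f}Y)\subset\mathbb H(X\xrightarrow{f}Y)$ be the set of all pseudo-bivariant classes for $f$, and let $\widetilde{\mathbb H}(X\xrightarrow{f}Y):=\mathbb{PH}(X\xrightarrow{f}Y)/\!\sim$, where $B\sim B'$ if and only if $g^*B\bullet c_*(\beta')=g^*B'\bullet c_*(\beta')$ for all independent squares with bottom map $g:Y'\to Y$ and right side $f$, and all $\beta'\in F(Y')$. Then $\widetilde{\mathbb H}(X\xrightarrow{f}Y)$ is an abelian group and $\widetilde{\mathbb H}$ is a bivariant theory with the canonical operations induced from those of $\mathbb H$. Furthermore $$\widetilde{\mathbb H}(X\to pt)=\mathrm{Image}\bigl(c_*:F(X)\to H_*(X)\bigr).$$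
   Context: $\mathcal C$ is a category with a final object $pt$ and fiber products, with a class of ''confined'' morphisms (containing identities, closed under composition and under base change in independent squares) and a class of ''independent'' squares, which are Cartesian, contain the identity squares and are closed under horizontal and vertical composition; the product squares over $pt$ are independent, so that exterior products are defined. A bivariant theory $\mathbb B$ on $\mathcal C$ assigns to each morphism $f:X\to Y$ a (graded) abelian group $\mathbb B(X\xrightarrow{f}Y)$ with three operations (homomorphisms): (1) products $\bullet:\mathbb B(X\xrightarrow{f}Y)\otimes\mathbb B(Y\xrightarrow{g}Z)\to\mathbb B(X\xrightarrow{gf}Z)$; (2) pushforwards $f_*:\mathbb B(X\xrightarrow{gf}Z)\to\mathbb B(Y\xrightarrow{g}Z)$ for $f:X\to Y$ confined; (3) pullbacks $g^*:\mathbb B(X\xrightarrow{f}Y)\to\mathbb B(X'\xrightarrow{f'}Y')$ for each independent square with top $g':X'\to X$, bottom $g:Y'\to Y$, left side $f'$ and right side $f$. They satisfy the seven Fulton--MacPherson axioms: product is associative; pushforward is functorial; pullback is functorial; $f_*(\alpha\bullet\beta)=f_*\alpha\bullet\beta$; for independent squares stacked vertically, with $h:Z'\to Z$ at the bottom and $h':Y'\to Y$ in the middle, $h^*(\alpha\bullet\beta)=h'^*\alpha\bullet h^*\beta$; in the same situation with $f:X\to Y$ confined, with base change $f':X'\to Y'$, $h^*(f_*\alpha)=f'_*(h^*\alpha)$; and the projection formula $g'_*(g^*\alpha\bullet\beta)=\alpha\bullet g_*\beta$ for an independent square with $g:Y'\to Y$ confined, $\alpha\in\mathbb B(X\xrightarrow{f}Y)$,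 $\beta\in\mathbb B(Y'\xrightarrow{hg}Z)$, where $h:Y\to Z$. $B_*(X):=\mathbb B(X\to pt)$ is covariant for confined maps. The exterior product of $\alpha\in\mathbb B(X\to pt)$ and $\beta\in\mathbb B(Y'\to pt)$ is $\alpha\times\beta:=g^*\alpha\bullet\beta\in\mathbb B(X\times Y'\to pt)$, where $g:Y'\to pt$. Naturality of $c_*$ means that it is a collection of homomorphisms commuting with pushforward by confined maps; commuting with exterior products means $c_*(\alpha\times\beta)=c_*(\alpha)\times c_*(\beta)$. Pseudo-bivariant classes: $\widetilde{\mathbb F}(X\xrightarrow{f}Y)$ is the set of all $\alpha\in\mathbb F(X\xrightarrow{f}Y)$ for which there exists $B_\alpha\in\mathbb H(X\xrightarrow{f}Y)$ such that for every independent square with bottom map $g:Y'\to Y$ and right side $f$, and every $\beta'\in F(Y')$, $c_*(g^*\alpha\bullet\beta')=g^*B_\alpha\bullet c_*(\beta')$. Any such $B_\alpha$ is called a pseudo-bivariant class of $\alpha$. $\mathbb{PH}(X\xrightarrow{f}Y)$ is the set of all $B\in\mathbb H(X\xrightarrow{f}Y)$ that are a pseudo-bivariant class of some $\alpha\in\widetilde{\mathbb F}(X\xrightarrow{f}Y)$; it is stable under the three bivariant operations of $\mathbb H$. Writing $[B]$ for the equivalence class of $B$, the induced operations are $[B_1]+[B_2]=[B_1+B_2]$, $[B_1]\,\widetilde\bullet\,[B_2]=[B_1\bullet B_2]$, $f_\bigstar[B]=[f_*B]$ for $f$ confined, and $g^\bigstar[B]=[g^*B]$. On $\mathbb{PH}(X\to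 pt)$ the relation $\sim$ is the identity relation, so $\widetilde{\mathbb H}(X\to pt)=\mathbb{PH}(X\to pt)$ is regarded as a subset of $H_*(X)$.
   Formalization: Added assumption, without which the claim fails: every independent square over a composite is a vertical stack of two independent squares, and each confined map into Y has an independent base change along the top of any independent square with right side Y→Z. *)

(* Defs.v *)
From HB Require Import structures.
From mathcomp Require Import all_boot all_order all_algebra generic_quotient.
From mathcomp Require Import boolp.

Set Implicit Arguments.
Unset Strict Implicit.
Unset Printing Implicit Defensive.

Import GRing.Theory.
Local Open Scope ring_scope.
Local Open Scope quotient_scope.

Reserved Notation "g \c f" (at level 50, left associativity).

Record category := Category {
  obj :> Type;
  mor : obj -> obj -> Type;
  idm : forall X, mor X X;
  mcomp : forall X Y Z, mor Y Z -> mor X Y -> mor X Z;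
  comp_idl : forall X Y (f : mor X Y), mcomp (idm Y) f = f;
  comp_idr : forall X Y (f : mor X Y), mcomp f (idm X) = f;
  comp_assoc : forall X Y Z W (f : mor X Y) (g : mor Y Z) (h : mor Z W),
    mcomp h (mcomp g f) = mcomp (mcomp h g) f
}.

Arguments mor {c} X Y.
Arguments idm {c} X.
Arguments mcomp {c X Y Z} g f.
Notation "g \c f" := (mcomp g f).

(* Squares are always given in the order top, left, right, bottom:

          X' --g'--> X
          |          |
          f'         f
          |          |
          Y' --g --> Y                                                       *)
Definition cartesian (C : category) (X' X Y' Y : C)
    (g' : mor X' X) (f' : mor X' Y') (f : mor X Y) (g : mor Y' Y) : Prop :=
  f \c g' = g \c f' /\
  forall (W : C) (u : mor W X) (v : mor W Y'), f \c u = g \c v ->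
    exists! w : mor W X', g' \c w = u /\ f' \c w = v.

(* The categories on which bivariant theories live.  As the projection
   formula pushes forward along the top g' of an independent square whose
   bottom g is confined, base change of confined maps is required in both
   directions. *)
Record bivariant_category := BivariantCategory {
  base_cat :> category;
  pt : base_cat;
  to_pt : forall X : base_cat, mor X pt;
  to_pt_unique : forall (X : base_cat) (f : mor X pt), f = to_pt X;
  fiber_products : forall (X Y Z : base_cat) (f : mor X Z) (g : mor Y Z),
    exists (P : base_cat) (p : mor P X) (q : mor P Y), cartesian p q f g;

  confined : forall X Y : base_cat, mor X Y -> Prop;
  confined_id : forall X : base_cat, confined (idm X);
  confined_comp : forall (X Y Z : base_cat) (f : mor X Y) (g : mor Y Z),
    confined f -> confined g -> confined (g \c f);

  independent : forall X' X Y' Y : base_cat,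
    mor X' X -> mor X' Y' -> mor X Y -> mor Y' Y -> Prop;
  independent_cartesian : forall (X' X Y' Y : base_cat)
      (g' : mor X' X) (f' : mor X' Y') (f : mor X Y) (g : mor Y' Y),
    independent g' f' f g -> cartesian g' f' f g;
  independent_idh : forall (X Y : base_cat) (f : mor X Y),
    independent (idm X) f f (idm Y);
  independent_idv : forall (X Y : base_cat) (f : mor X Y),
    independent f (idm X) (idm Y) f;
  independent_hcomp : forall (X'' X' X Y'' Y' Y : base_cat)
      (h' : mor X'' X') (g' : mor X' X)
      (f'' : mor X'' Y'') (f' : mor X' Y') (f : mor X Y)
      (h : mor Y'' Y') (g : mor Y' Y),
    independent h' f'' f' h -> independent g' f' f g ->
    independent (g' \c h') f'' f (g \c h);
  independent_vcomp : forall (X' X Y' Y Z' Z : base_cat)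
      (h'' : mor X' X) (f' : mor X' Y') (f : mor X Y)
      (h' : mor Y' Y) (g' : mor Y' Z') (g : mor Y Z) (h : mor Z' Z),
    independent h'' f' f h' -> independent h' g' g h ->
    independent h'' (g' \c f') (g \c f) h;
  independent_product : forall (P X Y : base_cat) (p : mor P X) (q : mor P Y),
    cartesian p q (to_pt X) (to_pt Y) ->
    independent p q (to_pt X) (to_pt Y);

  confined_left : forall (X' X Y' Y : base_cat)
      (g' : mor X' X) (f' : mor X' Y') (f : mor X Y) (g : mor Y' Y),
    independent g' f' f g -> confined f -> confined f';
  confined_top : forall (X' X Y' Y : base_cat)
      (g' : mor X' X) (f' : mor X' Y') (f : mor X Y) (g : mor Y' Y),
    independent g' f' f g -> confined g -> confined g'
}.

Arguments pt {b}.
Arguments to_pt {b} X.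

Lemma to_pt_comp (C : bivariant_category) (X Y : C) (f : mor X Y) :
  to_pt X = to_pt Y \c f.
Proof. by rewrite -(to_pt_unique (to_pt Y \c f)). Qed.

(* Base changes of towers: an independent square over a composite g \c f is a
   tower of two independent squares, and a confined map f : X -> Y can be base
   changed along the top h' of an independent square over some g : Y -> Z.
   Both hold when all fiber squares are independent.  This is what makes
   h^*(a . b) = h'^*a . h^*b and h^*(f_* a) = f'_*(h^*a) available for an
   arbitrary independent square with bottom h, and pseudo-bivariant classes need
   not be stable under products without it. *)
Definition has_towers (C : bivariant_category) : Prop :=
  (forall (X' X Y Z' Z : C) (h'' : mor X' X) (k : mor X' Z')
      (f : mor X Y) (g : mor Y Z) (h : mor Z' Z),
    independent h'' k (g \c f) h ->
    exists (Y' : C) (h' : mor Y' Y) (f' : mor X' Y') (g' : mor Y' Z'),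
      [/\ k = g' \c f', independent h'' f' f h' & independent h' g' g h]) /\
  (forall (X Y' Y Z' Z : C) (f : mor X Y)
      (h' : mor Y' Y) (g' : mor Y' Z') (g : mor Y Z) (h : mor Z' Z),
    confined f -> independent h' g' g h ->
    exists (X' : C) (h'' : mor X' X) (f' : mor X' Y'),
      independent h'' f' f h').

(* To avoid transports along associativity of composition, products and
   pushforwards take a morphism h together with a proof that h is the relevant
   composite, rather than being indexed by the composite itself. *)
Record bivariant_structure (C : bivariant_category)
    (B : forall X Y : C, mor X Y -> zmodType) := BivariantStructure {
  bprod : forall (X Y Z : C) (f : mor X Y) (g : mor Y Z) (h : mor X Z),
    h = g \c f -> B X Y f -> B Y Z g -> B X Z h;
  bpush : forall (X Y Z : C) (f : mor X Y) (g : mor Y Z) (h : mor X Z),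
    confined f -> h = g \c f -> B X Z h -> B Y Z g;
  bpull : forall (X' X Y' Y : C)
      (g' : mor X' X) (f' : mor X' Y') (f : mor X Y) (g : mor Y' Y),
    independent g' f' f g -> B X Y f -> B X' Y' f';

  bprodDl : forall (X Y Z : C) (f : mor X Y) (g : mor Y Z) (h : mor X Z)
      (e : h = g \c f) (a a' : B X Y f) (b : B Y Z g),
    bprod e (a + a') b = bprod e a b + bprod e a' b;
  bprodDr : forall (X Y Z : C) (f : mor X Y) (g : mor Y Z) (h : mor X Z)
      (e : h = g \c f) (a : B X Y f) (b b' : B Y Z g),
    bprod e a (b + b') = bprod e a b + bprod e a b';
  bpushD : forall (X Y Z : C) (f : mor X Y) (g : mor Y Z) (h : mor X Z)
      (cf : confined f) (e : h = g \c f) (a a' : B X Z h),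
    bpush cf e (a + a') = bpush cf e a + bpush cf e a';
  bpullD : forall (X' X Y' Y : C)
      (g' : mor X' X) (f' : mor X' Y') (f : mor X Y) (g : mor Y' Y)
      (s : independent g' f' f g) (a a' : B X Y f),
    bpull s (a + a') = bpull s a + bpull s a';

  bprodA : forall (X Y Z W : C) (f : mor X Y) (g : mor Y Z) (h : mor Z W)
      (gf : mor X Z) (hg : mor Y W) (hgf : mor X W)
      (e1 : gf = g \c f) (e2 : hgf = h \c gf)
      (e3 : hg = h \c g) (e4 : hgf = hg \c f)
      (a : B X Y f) (b : B Y Z g) (c : B Z W h),
    bprod e2 (bprod e1 a b) c = bprod e4 a (bprod e3 b c);

  bpush_id : forall (X Z : C) (g : mor X Z) (ci : confined (idm X))
      (e : g = g \c idm X) (a : B X Z g),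
    bpush ci e a = a;
  bpush_comp : forall (X Y Z W : C) (f : mor X Y) (g : mor Y Z) (h : mor Z W)
      (hg : mor Y W) (hgf : mor X W)
      (cf : confined f) (cg : confined g) (cgf : confined (g \c f))
      (e1 : hgf = h \c (g \c f)) (e2 : hgf = hg \c f) (e3 : hg = h \c g)
      (a : B X W hgf),
    bpush cgf e1 a = bpush cg e3 (bpush cf e2 a);

  bpull_id : forall (X Y : C) (f : mor X Y)
      (s : independent (idm X) f f (idm Y)) (a : B X Y f),
    bpull s a = a;
  bpull_comp : forall (X'' X' X Y'' Y' Y : C)
      (h' : mor X'' X') (g' : mor X' X)
      (f'' : mor X'' Y'') (f' : mor X' Y') (f : mor X Y)
      (h : mor Y'' Y') (g : mor Y' Y)
      (s1 : independent h' f'' f' h) (s2 : independent g' f' f g)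
      (s12 : independent (g' \c h') f'' f (g \c h)) (a : B X Y f),
    bpull s12 a = bpull s1 (bpull s2 a);

  bpush_prod : forall (X Y Z W : C) (f : mor X Y) (g : mor Y Z) (h : mor Z W)
      (gf : mor X Z) (hg : mor Y W) (hgf : mor X W) (cf : confined f)
      (e1 : gf = g \c f) (e2 : hgf = h \c gf)
      (e3 : hg = h \c g) (e4 : hgf = hg \c f)
      (a : B X Z gf) (b : B Z W h),
    bpush cf e4 (bprod e2 a b) = bprod e3 (bpush cf e1 a) b;

  bpull_prod : forall (X' X Y' Y Z' Z : C)
      (h'' : mor X' X) (f' : mor X' Y') (f : mor X Y)
      (h' : mor Y' Y) (g' : mor Y' Z') (g : mor Y Z) (h : mor Z' Z)
      (gf : mor X Z) (gf' : mor X' Z') (e : gf = g \c f) (e' : gf' = g' \c f')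
      (s1 : independent h'' f' f h') (s2 : independent h' g' g h)
      (s12 : independent h'' gf' gf h)
      (a : B X Y f) (b : B Y Z g),
    bpull s12 (bprod e a b) = bprod e' (bpull s1 a) (bpull s2 b);

  bpull_push : forall (X' X Y' Y Z' Z : C)
      (h'' : mor X' X) (f' : mor X' Y') (f : mor X Y)
      (h' : mor Y' Y) (g' : mor Y' Z') (g : mor Y Z) (h : mor Z' Z)
      (gf : mor X Z) (gf' : mor X' Z') (e : gf = g \c f) (e' : gf' = g' \c f')
      (s1 : independent h'' f' f h') (s2 : independent h' g' g h)
      (s12 : independent h'' gf' gf h)
      (cf : confined f) (cf' : confined f') (a : B X Z gf),
    bpull s2 (bpush cf e a) = bpush cf' e' (bpull s12 a);

  bprojection : forall (X' X Y' Y Z : C)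
      (g' : mor X' X) (f' : mor X' Y') (f : mor X Y) (g : mor Y' Y)
      (h : mor Y Z) (hg : mor Y' Z) (hf : mor X Z) (k : mor X' Z)
      (s : independent g' f' f g) (cg : confined g) (cg' : confined g')
      (e1 : hg = h \c g) (e2 : k = hg \c f')
      (e3 : hf = h \c f) (e4 : k = hf \c g')
      (a : B X Y f) (b : B Y' Z hg),
    bpush cg' e4 (bprod e2 (bpull s a) b) = bprod e3 a (bpush cg e1 b)
}.

Record bivariant_theory (C : bivariant_category) := BivariantTheory {
  bgroup :> forall X Y : C, mor X Y -> zmodType;
  bstruct :> bivariant_structure bgroup
}.

Section Theory.
Variables (C : bivariant_category) (B : bivariant_theory C).

Definition cov (X : C) : zmodType := B X pt (to_pt X).

Definition cov_push (X Y : C) (f : mor X Y) (cf : confined f) :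
    cov X -> cov Y :=
  bpush B cf (to_pt_comp f).

Definition prod_cov (X Y : C) (f : mor X Y) (a : B X Y f) (b : cov Y) : cov X :=
  bprod B (to_pt_comp f) a b.

(* P, with projections p and q, is any product of X and Y. *)
Definition ext_prod (X Y P : C) (p : mor P X) (q : mor P Y)
    (prd : cartesian p q (to_pt X) (to_pt Y)) (a : cov X) (b : cov Y) : cov P :=
  prod_cov (bpull B (independent_product prd) a) b.

(* 1_pt is a neutral element for the bivariant product on either side; such an
   element is unique.  No units over other objects are required. *)
Definition unit_pt (u : cov pt) : Prop :=
  (forall (X : C) (f : mor X pt) (e : f = to_pt pt \c f) (a : B X pt f),
     bprod B e a u = a) /\
  (forall (X : C) (f : mor pt X) (e : f = f \c to_pt pt) (a : B pt X f),
     bprod B e u a = a).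

End Theory.

Section PseudoBivariant.
Variables (C : bivariant_category) (F H : bivariant_theory C).
Variable c : forall X : C, {additive cov F X -> cov H X}.

Definition natural : Prop :=
  forall (X Y : C) (f : mor X Y) (cf : confined f) (a : cov F X),
    c Y (cov_push cf a) = cov_push cf (c X a).

Definition commutes_ext_prod : Prop :=
  forall (X Y P : C) (p : mor P X) (q : mor P Y)
    (prd : cartesian p q (to_pt X) (to_pt Y)) (a : cov F X) (b : cov F Y),
    c P (ext_prod prd a b) = ext_prod prd (c X a) (c Y b).

Definition pseudo_bivariant_class (X Y : C) (f : mor X Y)
    (a : F X Y f) (b : H X Y f) : Prop :=
  forall (X' Y' : C) (g' : mor X' X) (f' : mor X' Y') (g : mor Y' Y)
    (s : independent g' f' f g) (b' : cov F Y'),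
    c X' (prod_cov (bpull F s a) b') = prod_cov (bpull H s b) (c Y' b').

Definition Ftilde (X Y : C) (f : mor X Y) (a : F X Y f) : Prop :=
  exists b : H X Y f, pseudo_bivariant_class a b.

Definition PH (X Y : C) (f : mor X Y) (b : H X Y f) : Prop :=
  exists2 a : F X Y f, Ftilde a & pseudo_bivariant_class a b.

Definition PHsim (X Y : C) (f : mor X Y) (b1 b2 : H X Y f) : Prop :=
  forall (X' Y' : C) (g' : mor X' X) (f' : mor X' Y') (g : mor Y' Y)
    (s : independent g' f' f g) (b' : cov F Y'),
    prod_cov (bpull H s b1) (c Y' b') = prod_cov (bpull H s b2) (c Y' b').

Section Quotient.
Variables (X Y : C) (f : mor X Y).

Definition PHtype := {b : H X Y f | `[< PH b >]}.

Definition PHrel (b1 b2 : PHtype) : bool := `[< PHsim (val b1) (val b2) >].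

Lemma PHrel_refl : reflexive PHrel.
Proof. by move=> b; apply/asboolP. Qed.

Lemma PHrel_sym : symmetric PHrel.
Proof.
move=> b1 b2; apply/asboolP/asboolP => e X' Y' g' f' g s b';
by symmetry; apply: e.
Qed.

Lemma PHrel_trans : transitive PHrel.
Proof.
move=> b2 b1 b3 /asboolP e1 /asboolP e2.
apply/asboolP => X' Y' g' f' g s b'.
exact: etrans (e1 _ _ _ _ _ s b') (e2 _ _ _ _ _ s b').
Qed.

Canonical PHequiv := EquivRel PHrel PHrel_refl PHrel_sym PHrel_trans.

Definition Htilde := {eq_quot PHequiv}.

(* x = [b]; this includes b being a pseudo-bivariant class *)
Definition is_class (b : H X Y f) (x : Htilde) : Prop :=
  exists2 b0 : PHtype, val b0 = b & x = \pi_Htilde b0.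

End Quotient.
End PseudoBivariant.

Arguments is_class {C F H} c {X Y f} b x.

(* Main.v *)
Require Import Defs.
From HB Require Import structures.
From mathcomp Require Import all_boot all_order all_algebra generic_quotient.
From mathcomp Require Import boolp.

Set Implicit Arguments.
Unset Strict Implicit.
Unset Printing Implicit Defensive.

Import GRing.Theory.
Local Open Scope ring_scope.

(** Pseudo-bivariant classes are stable under the operations of [H]: an
    independent square over a composite (resp. over the target of a
    pushforward) splits into (resp. extends to) a tower, so pulling back and
    multiplying by [c_* b'] can be carried out one storey at a time, each
    storey being covered by the defining identity of a pseudo-bivariant class.
    The relation is a congruence for the same reason; for the left factor of a
    product one also uses that [g^*B . c_* b'] is again in the image of [c_*].
    The axioms then descend from [H] to the quotient. Over the point,
    evaluating at the identity square and [1_pt] gives [B = c_* a], and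
    conversely [c_* a] is a pseudo-bivariant class of [a] because independent
    squares over the point are product squares. *)

(** * Products with classes over the point *)

Section BivariantLemmas.
Variables (C : bivariant_category) (B : bivariant_theory C).

Lemma bpull_irr (X' X Y' Y : C) (g' : mor X' X) (f' : mor X' Y') (f : mor X Y)
    (g : mor Y' Y) (s s' : independent g' f' f g) : bpull B s =1 bpull B s'.
Proof. by move=> a; rewrite (Prop_irrelevance s s'). Qed.

Lemma bpull0 (X' X Y' Y : C) (g' : mor X' X) (f' : mor X' Y') (f : mor X Y)
    (g : mor Y' Y) (s : independent g' f' f g) : bpull B s 0 = 0.
Proof. by apply: (addrI (bpull B s 0)); rewrite -bpullD !addr0. Qed.

Lemma bpullN (X' X Y' Y : C) (g' : mor X' X) (f' : mor X' Y') (f : mor X Y)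
    (g : mor Y' Y) (s : independent g' f' f g) (a : B X Y f) :
  bpull B s (- a) = - bpull B s a.
Proof. by apply: (addrI (bpull B s a)); rewrite -bpullD !subrr bpull0. Qed.

Lemma prod_covDl (X Y : C) (f : mor X Y) (a a' : B X Y f) (b : cov B Y) :
  prod_cov (a + a') b = prod_cov a b + prod_cov a' b.
Proof. exact: bprodDl. Qed.

Lemma prod_cov0 (X Y : C) (f : mor X Y) (b : cov B Y) :
  prod_cov (0 : B X Y f) b = 0.
Proof.
by apply: (addrI (prod_cov (0 : B X Y f) b)); rewrite -prod_covDl !addr0.
Qed.

Lemma prod_covN (X Y : C) (f : mor X Y) (a : B X Y f) (b : cov B Y) :
  prod_cov (- a) b = - prod_cov a b.
Proof.
by apply: (addrI (prod_cov a b)); rewrite -prod_covDl !subrr prod_cov0.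
Qed.

Lemma prod_cov_prod (X Y Z : C) (f : mor X Y) (g : mor Y Z) (h : mor X Z)
    (e : h = g \c f) (a : B X Y f) (b : B Y Z g) (d : cov B Z) :
  prod_cov (bprod B e a b) d = prod_cov a (prod_cov b d).
Proof. exact: bprodA. Qed.

Lemma prod_cov_push (X Y Z : C) (f : mor X Y) (g : mor Y Z) (h : mor X Z)
    (cf : confined f) (e : h = g \c f) (a : B X Z h) (d : cov B Z) :
  prod_cov (bpush B cf e a) d = cov_push cf (prod_cov a d).
Proof. by symmetry; apply: bpush_prod. Qed.

(** The tower [s1] over [s2] splits the pullback, and associativity then lets [d] be absorbed by the
    lower storey first; the result is an element over [Y'] on which the upper storey acts. *)
Lemma prod_cov_pull_prod (X' X Y' Y Z' Z : C)
    (h'' : mor X' X) (f' : mor X' Y') (f : mor X Y)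
    (h' : mor Y' Y) (g' : mor Y' Z') (g : mor Y Z) (h : mor Z' Z)
    (gf : mor X Z) (gf' : mor X' Z') (e : gf = g \c f) (e' : gf' = g' \c f')
    (s1 : independent h'' f' f h') (s2 : independent h' g' g h)
    (s12 : independent h'' gf' gf h)
    (a : B X Y f) (b : B Y Z g) (d : cov B Z') :
  prod_cov (bpull B s12 (bprod B e a b)) d =
  prod_cov (bpull B s1 a) (prod_cov (bpull B s2 b) d).
Proof. by rewrite (bpull_prod B e e' s1 s2) prod_cov_prod. Qed.

Lemma prod_cov_pull_push (X' X Y' Y Z' Z : C)
    (h'' : mor X' X) (f' : mor X' Y') (f : mor X Y)
    (h' : mor Y' Y) (g' : mor Y' Z') (g : mor Y Z) (h : mor Z' Z)
    (gf : mor X Z) (gf' : mor X' Z') (e : gf = g \c f) (e' : gf' = g' \c f')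
    (s1 : independent h'' f' f h') (s2 : independent h' g' g h)
    (s12 : independent h'' gf' gf h)
    (cf : confined f) (cf' : confined f') (a : B X Z gf) (d : cov B Z') :
  prod_cov (bpull B s2 (bpush B cf e a)) d =
  cov_push cf' (prod_cov (bpull B s12 a) d).
Proof. by rewrite (bpull_push B e e' s1 s2 s12 cf cf') prod_cov_push. Qed.

Lemma prod_cov_pull_idh (u : cov B pt) (X : C) (a : cov B X) : unit_pt u ->
  prod_cov (bpull B (independent_idh (to_pt X)) a) u = a.
Proof. by case=> u1 _; rewrite bpull_id /prod_cov u1. Qed.

(** [ext_prod] fixes one particular proof of independence; by proof irrelevance any [s] may replace
    it. *)
Lemma ext_prod_pull (X X' Y : C) (g' : mor X' X) (f' : mor X' Y)
    (prd : cartesian g' f' (to_pt X) (to_pt Y))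
    (s : independent g' f' (to_pt X) (to_pt Y)) (a : cov B X) (b : cov B Y) :
  prod_cov (bpull B s a) b = ext_prod prd a b.
Proof. by rewrite /ext_prod (bpull_irr s (independent_product prd)). Qed.

End BivariantLemmas.

(** * Stability of pseudo-bivariant classes *)

Section PseudoBivariantClasses.
Variables (C : bivariant_category) (F H : bivariant_theory C).
Variable c : forall X : C, {additive cov F X -> cov H X}.

Lemma PH_of_class (X Y : C) (f : mor X Y) (a : F X Y f) (b : H X Y f) :
  pseudo_bivariant_class c a b -> PH c b.
Proof. by move=> ab; exists a; first by exists b. Qed.

Lemma PH0 (X Y : C) (f : mor X Y) : PH c (0 : H X Y f).
Proof.
apply: (@PH_of_class _ _ _ 0) => X' Y' g' f' g s d.
by rewrite !bpull0 !prod_cov0 raddf0.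
Qed.

Lemma PHN (X Y : C) (f : mor X Y) (b : H X Y f) : PH c b -> PH c (- b).
Proof.
case=> a _ ab; apply: (@PH_of_class _ _ _ (- a)) => X' Y' g' f' g s d.
by rewrite !bpullN !prod_covN raddfN ab.
Qed.

Lemma PHD (X Y : C) (f : mor X Y) (b1 b2 : H X Y f) :
  PH c b1 -> PH c b2 -> PH c (b1 + b2).
Proof.
case=> a1 _ ab1 [a2 _ ab2].
apply: (@PH_of_class _ _ _ (a1 + a2)) => X' Y' g' f' g s d.
by rewrite !bpullD !prod_covDl raddfD ab1 ab2.
Qed.

Lemma PH_pull (X' X Y' Y : C) (g' : mor X' X) (f' : mor X' Y')
    (f : mor X Y) (g : mor Y' Y) (s : independent g' f' f g) (b : H X Y f) :
  PH c b -> PH c (bpull H s b).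
Proof.
case=> a _ ab; apply: (@PH_of_class _ _ _ (bpull F s a)).
move=> X'' Y'' h' f'' h s' d.
(* Pasting the test square [s'] for [f'] horizontally with [s] gives a test square for [f]. *)
by rewrite -!(bpull_comp _ s' s (independent_hcomp s' s)) ab.
Qed.

Lemma PH_prod (X Y Z : C) (f : mor X Y) (g : mor Y Z) (h : mor X Z)
    (e : h = g \c f) (b1 : H X Y f) (b2 : H Y Z g) :
  has_towers C -> PH c b1 -> PH c b2 -> PH c (bprod H e b1 b2).
Proof.
move=> [split_sq _] [a1 _ ab1] [a2 _ ab2].
apply: (@PH_of_class _ _ _ (bprod F e a1 a2)) => X' Z' h'' k w s d.
have [|Y' [h' [f' [g' [ek s1 s2]]]]] := split_sq _ _ _ _ _ h'' k f g w.
  by rewrite -e.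
(* Here [ab1] is applied on [s1] to the element [prod_cov (bpull F s2 a2) d] of F(Y'), and [ab2] on
   [s2] to [d]. *)
by rewrite !(prod_cov_pull_prod e ek s1 s2) ab1 ab2.
Qed.

Lemma PH_push (X Y Z : C) (f : mor X Y) (g : mor Y Z) (h : mor X Z)
    (cf : confined f) (e : h = g \c f) (b : H X Z h) :
  has_towers C -> natural c -> PH c b -> PH c (bpush H cf e b).
Proof.
move=> [_ extend_sq] c_nat [a _ ab].
apply: (@PH_of_class _ _ _ (bpush F cf e a)) => Y' Z' h' g' w s2 d.
(* The test square [s2] lies over [g] only; a storey over [f] is added so that the outer square
   tests [b] over [h]. *)
have [X' [h'' [f' s1]]] := extend_sq _ _ _ _ _ _ _ _ _ _ cf s2.
have s12 : independent h'' (g' \c f') h w.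
  by rewrite e; apply: independent_vcomp s1 s2.
have cf' := confined_left s1 cf.
by rewrite !(prod_cov_pull_push e erefl s1 s2 s12 cf cf') c_nat ab.
Qed.

(** * Compatibility of the relation with the operations *)

Lemma PHsimN (X Y : C) (f : mor X Y) (b b' : H X Y f) :
  PHsim c b b' -> PHsim c (- b) (- b').
Proof.
by move=> bb' X' Y' g' f' g s d; rewrite !bpullN !prod_covN bb'.
Qed.

Lemma PHsimD (X Y : C) (f : mor X Y) (b1 b1' b2 b2' : H X Y f) :
  PHsim c b1 b1' -> PHsim c b2 b2' -> PHsim c (b1 + b2) (b1' + b2').
Proof.
move=> bb1 bb2 X' Y' g' f' g s d.
by rewrite !bpullD !prod_covDl bb1 bb2.
Qed.

Lemma PHsim_pull (X' X Y' Y : C) (g' : mor X' X) (f' : mor X' Y')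
    (f : mor X Y) (g : mor Y' Y) (s : independent g' f' f g) (b b' : H X Y f) :
  PHsim c b b' -> PHsim c (bpull H s b) (bpull H s b').
Proof.
move=> bb' X'' Y'' h' f'' h s' d.
by rewrite -!(bpull_comp _ s' s (independent_hcomp s' s)) bb'.
Qed.

Lemma PHsim_prod (X Y Z : C) (f : mor X Y) (g : mor Y Z) (h : mor X Z)
    (e : h = g \c f) (b1 b1' : H X Y f) (b2 b2' : H Y Z g) :
  has_towers C -> PH c b2' -> PHsim c b1 b1' -> PHsim c b2 b2' ->
  PHsim c (bprod H e b1 b2) (bprod H e b1' b2').
Proof.
move=> [split_sq _] [a2 _ ab2] bb1 bb2 X' Z' h'' k w s d.
have [|Y' [h' [f' [g' [ek s1 s2]]]]] := split_sq _ _ _ _ _ h'' k f g w.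
  by rewrite -e.
(* [bb1] only compares products with elements in the image of [c]; [ab2] rewrites the product of the
   pulled-back [b2'] with [c Z' d] as such an element. *)
by rewrite !(prod_cov_pull_prod e ek s1 s2) bb2 -ab2 bb1.
Qed.

Lemma PHsim_push (X Y Z : C) (f : mor X Y) (g : mor Y Z) (h : mor X Z)
    (cf : confined f) (e : h = g \c f) (b b' : H X Z h) :
  has_towers C -> PHsim c b b' -> PHsim c (bpush H cf e b) (bpush H cf e b').
Proof.
move=> [_ extend_sq] bb' Y' Z' h' g' w s2 d.
have [X' [h'' [f' s1]]] := extend_sq _ _ _ _ _ _ _ _ _ _ cf s2.
have s12 : independent h'' (g' \c f') h w.
  by rewrite e; apply: independent_vcomp s1 s2.
have cf' := confined_left s1 cf.
by rewrite !(prod_cov_pull_push e erefl s1 s2 s12 cf cf') bb'.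
Qed.

(** * The theory over the point *)

Lemma pseudo_bivariant_class_pt (oneF : cov F pt) (oneH : cov H pt) (X : C)
    (a : cov F X) (b : cov H X) :
  unit_pt oneF -> unit_pt oneH -> commutes_ext_prod c -> c pt oneF = oneH ->
  pseudo_bivariant_class c a b <-> b = c X a.
Proof.
move=> oneFP oneHP c_ext c_one; split=> [ab | -> X' Y' g' f' g s d].
  have := ab _ _ _ _ _ (independent_idh (to_pt X)) oneF.
  by rewrite c_one !prod_cov_pull_idh.
(* The bottom map ends in [pt], hence is [to_pt Y']; the test square is then a product square and
   the required identity is compatibility with exterior products. *)
have eg := to_pt_unique g; subst g.
have prd := independent_cartesian s.
by rewrite !(ext_prod_pull prd) c_ext.
Qed.

Lemma PH_pt (oneF : cov F pt) (oneH : cov H pt) (X : C) (b : cov H X) :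
  unit_pt oneF -> unit_pt oneH -> commutes_ext_prod c -> c pt oneF = oneH ->
  PH c b <-> exists a : cov F X, b = c X a.
Proof.
move=> oneFP oneHP c_ext c_one.
have classP a := pseudo_bivariant_class_pt a b oneFP oneHP c_ext c_one.
by split=> [[a _ /classP] | [a /classP/PH_of_class]] //; exists a.
Qed.

Lemma PHsim_pt (oneF : cov F pt) (oneH : cov H pt) (X : C) (b b' : cov H X) :
  unit_pt oneH -> c pt oneF = oneH -> PHsim c b b' <-> b = b'.
Proof.
move=> oneHP c_one; split=> [bb' | -> //].
have := bb' _ _ _ _ _ (independent_idh (to_pt X)) oneF.
by rewrite c_one !prod_cov_pull_idh.
Qed.

(** * Classes and their representatives *)

Definition class_of (X Y : C) (f : mor X Y) (b : H X Y f) (Pb : PH c b) :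
    Htilde c f :=
  \pi_(Htilde c f)%qT (exist _ b (asboolT Pb) : PHtype c f).

Definition class_repr (X Y : C) (f : mor X Y) (x : Htilde c f) : H X Y f :=
  val (repr x).

Lemma PH_class_repr (X Y : C) (f : mor X Y) (x : Htilde c f) :
  PH c (class_repr x).
Proof. exact: asboolW (valP (repr x)). Qed.

(** Trades the quotient map for the chosen representative, leaving a condition inside H alone. *)
Lemma is_classP (X Y : C) (f : mor X Y) (b : H X Y f) (x : Htilde c f) :
  is_class c b x <-> PH c b /\ PHsim c b (class_repr x).
Proof.
split=> [[b0 <- ->] | [Pb bx]].
  split; first exact: asboolW (valP b0).
  have /eqP := reprK (\pi_(Htilde c f)%qT b0).
  by rewrite eq_sym eqmodE => /asboolP.
exists (exist _ b (asboolT Pb)) => //.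
by rewrite -[LHS]reprK; apply/eqP; rewrite eq_sym eqmodE; apply/asboolP.
Qed.

(** With [b'] computed from chosen representatives and [b] from arbitrary ones, this turns each
    congruence lemma into well-definedness of the induced operation. *)
Lemma is_class_class_of (X Y : C) (f : mor X Y) (b b' : H X Y f)
    (Pb' : PH c b') : PH c b -> PHsim c b b' -> is_class c b (class_of Pb').
Proof.
move=> Pb bb'; exists (exist _ b (asboolT Pb)) => //.
by apply/eqP; rewrite eq_sym eqmodE; apply/asboolP.
Qed.

Lemma is_class_repr (X Y : C) (f : mor X Y) (x : Htilde c f) :
  is_class c (class_repr x) x.
Proof. by apply/is_classP; split; first exact: PH_class_repr. Qed.

(** Transfer principle: every group law and bivariant axiom of the quotient is obtained by
    exhibiting representatives of both sides that agree in H. *)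
Lemma is_class_inj (X Y : C) (f : mor X Y) (b b' : H X Y f)
    (x x' : Htilde c f) :
  is_class c b x -> is_class c b' x' -> b = b' -> x = x'.
Proof.
move=> [b0 <- ->] [b0' <- ->] e.
by congr (\pi_(Htilde c f)%qT _); apply: val_inj.
Qed.

(** * The abelian group structure on the quotient *)

Section QuotientGroup.
Variables (X Y : C) (f : mor X Y).
Implicit Types (b : H X Y f) (x y : Htilde c f).

Definition class_zero : Htilde c f := class_of (PH0 f).
Definition class_opp x : Htilde c f := class_of (PHN (PH_class_repr x)).
Definition class_add x y : Htilde c f :=
  class_of (PHD (PH_class_repr x) (PH_class_repr y)).

Lemma is_class0 : is_class c (0 : H X Y f) class_zero.
Proof. by apply: is_class_class_of; first exact: PH0. Qed.

Lemma is_classN b x : is_class c b x -> is_class c (- b) (class_opp x).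
Proof.
case/is_classP=> Pb bx.
by apply: is_class_class_of; [apply: PHN | apply: PHsimN].
Qed.

Lemma is_classD b1 b2 x1 x2 :
  is_class c b1 x1 -> is_class c b2 x2 ->
  is_class c (b1 + b2) (class_add x1 x2).
Proof.
case/is_classP=> Pb1 bx1 /is_classP[Pb2 bx2].
by apply: is_class_class_of; [apply: PHD | apply: PHsimD].
Qed.

Lemma class_addA : associative class_add.
Proof.
move=> x y z; apply: is_class_inj (addrA _ _ _);
  do ?[apply: is_classD | apply: is_class_repr].
Qed.

Lemma class_addC : commutative class_add.
Proof.
move=> x y; apply: is_class_inj (addrC _ _);
  do ?[apply: is_classD | apply: is_class_repr].
Qed.

Lemma class_add0 : left_id class_zero class_add.
Proof.
move=> x; apply: is_class_inj (add0r _);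
  do ?[apply: is_classD | apply: is_class0 | apply: is_class_repr].
Qed.

Lemma class_addN : left_inverse class_zero class_opp class_add.
Proof.
move=> x; apply: is_class_inj (addNr (class_repr x));
  do ?[apply: is_classD | apply: is_classN | apply: is_class0
      | apply: is_class_repr].
Qed.

HB.instance Definition _ := Choice.on (Htilde c f).
HB.instance Definition _ := GRing.isZmodule.Build (Htilde c f)
  class_addA class_addC class_add0 class_addN.

End QuotientGroup.

(** * The induced bivariant operations *)

Hypotheses (C_towers : has_towers C) (c_nat : natural c).

Definition class_prod (X Y Z : C) (f : mor X Y) (g : mor Y Z) (h : mor X Z)
    (e : h = g \c f) (x : Htilde c f) (y : Htilde c g) : Htilde c h :=
  class_of (PH_prod e C_towers (PH_class_repr x) (PH_class_repr y)).

Definition class_push (X Y Z : C) (f : mor X Y) (g : mor Y Z) (h : mor X Z)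
    (cf : confined f) (e : h = g \c f) (x : Htilde c h) : Htilde c g :=
  class_of (PH_push cf e C_towers c_nat (PH_class_repr x)).

Definition class_pull (X' X Y' Y : C) (g' : mor X' X) (f' : mor X' Y')
    (f : mor X Y) (g : mor Y' Y) (s : independent g' f' f g)
    (x : Htilde c f) : Htilde c f' :=
  class_of (PH_pull s (PH_class_repr x)).

Lemma is_class_prod (X Y Z : C) (f : mor X Y) (g : mor Y Z) (h : mor X Z)
    (e : h = g \c f) (b1 : H X Y f) (b2 : H Y Z g)
    (x1 : Htilde c f) (x2 : Htilde c g) :
  is_class c b1 x1 -> is_class c b2 x2 ->
  is_class c (bprod H e b1 b2) (class_prod e x1 x2).
Proof.
case/is_classP=> Pb1 bx1 /is_classP[Pb2 bx2].
apply: is_class_class_of; first exact: PH_prod.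
by apply: PHsim_prod => //; apply: PH_class_repr.
Qed.

Lemma is_class_push (X Y Z : C) (f : mor X Y) (g : mor Y Z) (h : mor X Z)
    (cf : confined f) (e : h = g \c f) (b : H X Z h) (x : Htilde c h) :
  is_class c b x -> is_class c (bpush H cf e b) (class_push cf e x).
Proof.
case/is_classP=> Pb bx.
by apply: is_class_class_of; [apply: PH_push | apply: PHsim_push].
Qed.

Lemma is_class_pull (X' X Y' Y : C) (g' : mor X' X) (f' : mor X' Y')
    (f : mor X Y) (g : mor Y' Y) (s : independent g' f' f g)
    (b : H X Y f) (x : Htilde c f) :
  is_class c b x -> is_class c (bpull H s b) (class_pull s x).
Proof.
case/is_classP=> Pb bx.
by apply: is_class_class_of; [apply: PH_pull | apply: PHsim_pull].
Qed.

(** Follows the operations of the quotient down to the variables, building the same expression in H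
    with [class_repr] at the leaves. *)
Local Ltac classify :=
  do ?[apply: is_class_prod | apply: is_class_push | apply: is_class_pull
      | apply: is_classD | apply: is_class_repr].

Definition Htilde_structure :
  bivariant_structure (fun X Y (f : mor X Y) => Htilde c f : zmodType).
Proof.
apply: (@BivariantStructure C (fun X Y (f : mor X Y) => Htilde c f : zmodType)
  class_prod class_push class_pull).
(* In each case [classify] determines the elements of H representing the two sides, and what remains
   is the same axiom for [H]. *)
- move=> *; apply: is_class_inj; [classify | classify | exact: bprodDl].
- move=> *; apply: is_class_inj; [classify | classify | exact: bprodDr].
- move=> *; apply: is_class_inj; [classify | classify | exact: bpushD].
- move=> *; apply: is_class_inj; [classify | classify | exact: bpullD].
- move=> *; apply: is_class_inj; [classify | classify | exact: bprodA].
- move=> *; apply: is_class_inj; [classify | classify | exact: bpush_id].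
- move=> *; apply: is_class_inj; [classify | classify | exact: bpush_comp].
- move=> *; apply: is_class_inj; [classify | classify | exact: bpull_id].
- move=> *; apply: is_class_inj; [classify | classify | exact: bpull_comp].
- move=> *; apply: is_class_inj; [classify | classify | exact: bpush_prod].
- move=> *; apply: is_class_inj; [classify | classify | exact: bpull_prod].
- move=> *; apply: is_class_inj; [classify | classify | exact: bpull_push].
- move=> *; apply: is_class_inj; [classify | classify | exact: bprojection].
(* Kept transparent so that the operations of this structure unfold to [class_prod], [class_push]
   and [class_pull] in the final theorem. *)
Defined.

End PseudoBivariantClasses.

Theorem mainTheorem7 (C : bivariant_category) (C_towers : has_towers C)
    (F H : bivariant_theory C)
    (c : forall X : C, {additive cov F X -> cov H X})
    (oneF : cov F pt) (oneH : cov H pt)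
    (oneFP : unit_pt oneF) (oneHP : unit_pt oneH)
    (c_nat : natural c) (c_ext : commutes_ext_prod c) (c_one : c pt oneF = oneH) :
  (exists (zmod : forall (X Y : C) (f : mor X Y), GRing.Zmodule (Htilde c f))
          (ops : bivariant_structure
                   (fun X Y (f : mor X Y) => GRing.Zmodule.Pack (zmod X Y f))),
     let Ht := BivariantTheory ops in
     [/\ forall (X Y : C) (f : mor X Y) (b1 b2 : H X Y f) (x1 x2 : Ht X Y f),
           is_class c b1 x1 -> is_class c b2 x2 ->
           is_class c (b1 + b2) (x1 + x2),
         forall (X Y Z : C) (f : mor X Y) (g : mor Y Z) (h : mor X Z)
             (e : h = g \c f) (b1 : H X Y f) (b2 : H Y Z g)
             (x1 : Ht X Y f) (x2 : Ht Y Z g),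
           is_class c b1 x1 -> is_class c b2 x2 ->
           is_class c (bprod H e b1 b2) (bprod Ht e x1 x2),
         forall (X Y Z : C) (f : mor X Y) (g : mor Y Z) (h : mor X Z)
             (cf : confined f) (e : h = g \c f) (b : H X Z h) (x : Ht X Z h),
           is_class c b x -> is_class c (bpush H cf e b) (bpush Ht cf e x)
       & forall (X' X Y' Y : C) (g' : mor X' X) (f' : mor X' Y')
             (f : mor X Y) (g : mor Y' Y) (s : independent g' f' f g)
             (b : H X Y f) (x : Ht X Y f),
           is_class c b x -> is_class c (bpull H s b) (bpull Ht s x)])
  /\
  (forall X : C,
     (forall b1 b2 : cov H X, PH c b1 -> PH c b2 ->
        PHsim c b1 b2 <-> b1 = b2) /\
     (forall b : cov H X, PH c b <-> exists a : cov F X, b = c X a)).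
Proof.
split; last first.
  move=> X; split=> [b1 b2 _ _ | b].
    exact: (PHsim_pt b1 b2 oneHP c_one).
  exact: (PH_pt b oneFP oneHP c_ext c_one).
(* Packing this class gives back, up to conversion, the group structure over which
   [Htilde_structure] is built. *)
exists (fun X Y f => GRing.Zmodule.class (Htilde c f : zmodType)).
exists (Htilde_structure C_towers c_nat); split.
- by move=> *; apply: is_classD.
- by move=> *; apply: is_class_prod.
- by move=> *; apply: is_class_push.
- by move=> *; apply: is_class_pull.
Qed.
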